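(* There does not exist an explicit exponential Runge--Kutta method of order 5 with less than or equal to 6 stages. That is, for no $s\le 6$ do there exist nodes $c_2,\dots,c_s$ and coefficient functions $a_{ij}$ $(2\le j<i\le s)$, $b_i$ $(2\le i\le s)$ of an $s$-stage explicit exponential Runge--Kutta method that satisfy the order conditions 1--7 of the context, condition 8 at $Z=0$, and conditions 9--16 with $b_i(Z)$ replaced by $b_i(0)$.
   Context: The functions $\varphi_k$ are the entire functions $\varphi_0(z)=\mathrm{e}^z$, $\varphi_k(z)=\int_0^1 \mathrm{e}^{(1-\theta)z}\frac{\theta^{k-1}}{(k-1)!}\,\mathrm{d}\theta$ for $k\ge1$. An $s$-stage explicit exponential Runge--Kutta method for $u'=F(u)=Au+g(u)$ has real nodes $c_2,\dots,c_s$ (with the convention $c_1=0$, $U_{n1}=u_n$) and coefficient functions $a_{ij}(z)$ ($2\le j<i\le s$), $b_i(z)$ ($2\le i\le s$), which are linear combinations of the functions $\varphi_k(z)$ and scaled versions $\varphi_k(c_l z)$, $k\ge 1$. It reads $$U_{ni}=u_n+c_ih\varphi_1(c_ihA)F(u_n)+h\sum_{j=2}^{i-1}a_{ij}(hA)D_{nj},\qquad u_{n+1}=u_n+h\varphi_1(hA)F(u_n)+h\sum_{i=2}^s b_i(hA)D_{ni},$$ with $D_{ni}=g(U_{ni})-g(u_n)$. Define $\psi_{j,i}(Z)=\sum_{k=2}^{i-1}a_{ik}(Z)\frac{c_k^{j-1}}{(j-1)!}-c_i^j\varphi_j(c_iZ)$. Order conditions. Below, $Z,J,K,L$ denote arbitrary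 square matrices of the same format (of any size) and $B$ an arbitrary bilinear mapping of appropriate dimensions; each condition is required for all of these. $B(M,M)$ denotes the bilinear map $(x,y)\mapsto B(Mx,My)$. All outer sums run over $i=2,\dots,s$. 1: $\sum b_i(Z)c_i=\varphi_2(Z)$. 2: $\sum b_i(Z)\frac{c_i^2}{2!}=\varphi_3(Z)$. 3: $\sum b_i(Z)J\psi_{2,i}(Z)=0$. 4: $\sum b_i(Z)\frac{c_i^3}{3!}=\varphi_4(Z)$. 5: $\sum b_i(Z)J\psi_{3,i}(Z)=0$. 6: $\sum b_i(Z)J\sum_{j=2}^{i-1}a_{ij}(Z)J\psi_{2,j}(Z)=0$. 7: $\sum b_i(Z)c_iK\psi_{2,i}(Z)=0$. 8: $\sum b_i(Z)\frac{c_i^4}{4!}=\varphi_5(Z)$. 9: $\sum b_i(Z)J\psi_{4,i}(Z)=0$. 10: $\sum b_i(Z)J\sum_{j=2}^{i-1}a_{ij}(Z)J\psi_{3,j}(Z)=0$. 11: $\sum b_i(Z)J\sum_{j=2}^{i-1}a_{ij}(Z)J\sum_{k=2}^{j-1}a_{jk}(Z)J\psi_{2,k}(Z)=0$. 12: $\sum b_i(Z)J\sum_{j=2}^{i-1}a_{ij}(Z)c_jK\psi_{2,j}(Z)=0$. 13: $\sum b_i(Z)c_iK\psi_{3,i}(Z)=0$. 14: $\sum b_i(Z)c_iK\sum_{j=2}^{i-1}a_{ij}(Z)J\psi_{2,j}(Z)=0$. 15: $\sum b_i(Z)B(\psi_{2,i}(Z),\psi_{2,i}(Z))=0$. 16: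 $\sum b_i(Z)c_i^2L\psi_{2,i}(Z)=0$. ''Of order 5'' means: conditions 1--7 hold, condition 8 holds for $Z=0$ (i.e. $\sum b_i(0)\frac{c_i^4}{4!}=\varphi_5(0)$), and conditions 9--16 hold with $b_i(0)$ in place of $b_i(Z)$. *)

(* Defs.v *)
From mathcomp Require Import all_boot all_order all_algebra.
From mathcomp Require Export sesquilinear.
From mathcomp Require Import all_classical all_reals all_analysis.
From mathcomp Require Import complex.

Set Implicit Arguments.
Unset Strict Implicit.
Unset Printing Implicit Defensive.
Import Order.TTheory GRing.Theory Num.Theory.
Import numFieldNormedType.Exports.
Local Open Scope classical_set_scope.
Local Open Scope ring_scope.

(* Matrices and the coefficients of the linear combinations are taken either
   all over the reals or all over the complex numbers; the nodes are real in
   both cases. *)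
Inductive scalars := Reals | Complexes.

Definition field_of (R : realType) (F : scalars) : numFieldType :=
  match F with Reals => R | Complexes => R[i] end.

Definition emb (R : realType) (F : scalars) : R -> field_of R F :=
  match F return R -> field_of R F with
  | Reals => fun x => x
  | Complexes => fun x => (x%:C)%C
  end.

Definition int01 (R : realType) (F : scalars) :
    (R -> field_of R F) -> field_of R F :=
  match F return (R -> field_of R F) -> field_of R F with
  | Reals => fun f => \int[lebesgue_measure]_(t in `[0%R, 1%R]) f t
  | Complexes => fun f =>
      ((\int[lebesgue_measure]_(t in `[0%R, 1%R]) complex.Re (f t))
       +i* (\int[lebesgue_measure]_(t in `[0%R, 1%R]) complex.Im (f t)))%C
  end.

Definition expm (K : numFieldType) (n : nat) (Z : 'M[K]_n) : 'M[K]_n :=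
  \matrix_(i, j) limn (series (fun m : nat => (Z ^+ m) i j / m`!%:R : K)).

(* phi_k at a square matrix: the integral is taken entrywise. *)
Definition phi (R : realType) (F : scalars) (k n : nat)
    (Z : 'M[field_of R F]_n) : 'M[field_of R F]_n :=
  if k is 0 then expm Z else
  \matrix_(i, j) int01 (fun t : R =>
    expm (emb F (1 - t) *: Z) i j * emb F (t ^+ k.-1 / (k.-1)`!%:R)).

(* A scalar function is represented by the family of its evaluations at
   square matrices of every size.  Only finitely many phi_k occur; l = 1 is
   allowed, and contributes constants because of the convention c 1 = 0. *)
Definition phi_comb (R : realType) (F : scalars) (s : nat) (c : nat -> R)
    (f : forall n : nat, 'M[field_of R F]_n -> 'M[field_of R F]_n) : Prop :=
  exists (p : nat) (alpha : nat -> field_of R F)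
         (beta : nat -> nat -> field_of R F),
  forall (n : nat) (Z : 'M[field_of R F]_n),
    f n Z = \sum_(1 <= k < p.+1) alpha k *: phi k Z
          + \sum_(1 <= k < p.+1) \sum_(1 <= l < s.+1)
              beta k l *: phi k (emb F (c l) *: Z).

(* Stages are numbered from 1 to s.  Values of [node], [acoef], [bcoef] at
   indices outside the ranges of [erk_a] and [erk_b] are never used. *)
Record expRKmethod (R : realType) (F : scalars) (s : nat) := ExpRKmethod {
  node : nat -> R;
  acoef : nat -> nat ->
    forall n : nat, 'M[field_of R F]_n -> 'M[field_of R F]_n;
  bcoef : nat -> forall n : nat, 'M[field_of R F]_n -> 'M[field_of R F]_n;
  erk_node1 : node 1 = 0;
  erk_a : forall i j : nat,
    (2 <= j)%N -> (j < i)%N -> (i <= s)%N -> phi_comb s node (acoef i j);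
  erk_b : forall i : nat,
    (2 <= i)%N -> (i <= s)%N -> phi_comb s node (bcoef i)
}.

Definition cnode (R : realType) (F : scalars) (s : nat) (M : expRKmethod R F s)
    (i : nat) : field_of R F := emb F (node M i).

Definition psi (R : realType) (F : scalars) (s : nat) (M : expRKmethod R F s)
    (j i n : nat) (Z : 'M[field_of R F]_n) : 'M[field_of R F]_n :=
  \sum_(2 <= k < i) (cnode M k ^+ j.-1 / (j.-1)`!%:R) *: acoef M i k Z
  - cnode M i ^+ j *: phi j (cnode M i *: Z).

Definition conditions_1_7 (R : realType) (F : scalars) (s : nat)
    (M : expRKmethod R F s) : Prop :=
  let c := cnode M in
  forall (n : nat) (Z J K : 'M[field_of R F]_n),
  let a i j := acoef M i j Z in
  let b i := bcoef M i Z in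
  let psi j i := psi M j i Z in
  [/\ \sum_(2 <= i < s.+1) c i *: b i = phi 2 Z,
      \sum_(2 <= i < s.+1) (c i ^+ 2 / 2`!%:R) *: b i = phi 3 Z &
      \sum_(2 <= i < s.+1) b i *m J *m psi 2 i = 0] /\
  [/\ \sum_(2 <= i < s.+1) (c i ^+ 3 / 3`!%:R) *: b i = phi 4 Z,
      \sum_(2 <= i < s.+1) b i *m J *m psi 3 i = 0,
      \sum_(2 <= i < s.+1)
        b i *m J *m (\sum_(2 <= j < i) a i j *m J *m psi 2 j) = 0 &
      \sum_(2 <= i < s.+1) b i *m (c i *: K) *m psi 2 i = 0].

Definition condition_8_at0 (R : realType) (F : scalars) (s : nat)
    (M : expRKmethod R F s) : Prop :=
  let c := cnode M in
  forall n : nat,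
  \sum_(2 <= i < s.+1)
    (c i ^+ 4 / 4`!%:R) *: bcoef M i (0 : 'M[field_of R F]_n)
    = phi 5 (0 : 'M[field_of R F]_n).

Definition conditions_9_16_b0 (R : realType) (F : scalars) (s : nat)
    (M : expRKmethod R F s) : Prop :=
  let c := cnode M in
  forall (n : nat) (Z J K L : 'M[field_of R F]_n)
    (B : {bilinear 'cV[field_of R F]_n -> 'cV[field_of R F]_n
                   -> 'cV[field_of R F]_n}),
  let a i j := acoef M i j Z in
  let b0 i := bcoef M i (0 : 'M[field_of R F]_n) in
  let psi j i := psi M j i Z in
  [/\ \sum_(2 <= i < s.+1) b0 i *m J *m psi 4 i = 0,
      \sum_(2 <= i < s.+1)
        b0 i *m J *m (\sum_(2 <= j < i) a i j *m J *m psi 3 j) = 0,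
      \sum_(2 <= i < s.+1)
        b0 i *m J *m (\sum_(2 <= j < i) a i j *m J *m
          (\sum_(2 <= k < j) a j k *m J *m psi 2 k)) = 0 &
      \sum_(2 <= i < s.+1)
        b0 i *m J *m (\sum_(2 <= j < i) a i j *m (c j *: K) *m psi 2 j) = 0] /\
  [/\ \sum_(2 <= i < s.+1) b0 i *m (c i *: K) *m psi 3 i = 0,
      \sum_(2 <= i < s.+1)
        b0 i *m (c i *: K) *m (\sum_(2 <= j < i) a i j *m J *m psi 2 j) = 0,
      (forall x y : 'cV[field_of R F]_n,
        \sum_(2 <= i < s.+1) b0 i *m B (psi 2 i *m x) (psi 2 i *m y) = 0) &
      \sum_(2 <= i < s.+1) b0 i *m (c i ^+ 2 *: L) *m psi 2 i = 0].

Definition order5 (R : realType) (F : scalars) (s : nat) (M : expRKmethod R F s) :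
    Prop :=
  [/\ conditions_1_7 M, condition_8_at0 M & conditions_9_16_b0 M].

(* Main.v *)
Require Import Defs.
From HB Require Import structures.
From mathcomp Require Import all_boot all_order all_algebra.
From mathcomp Require Import all_classical all_reals all_analysis.
From mathcomp Require Import complex ring zify.

Set Implicit Arguments.
Unset Strict Implicit.
Unset Printing Implicit Defensive.
Import Order.TTheory GRing.Theory Num.Theory.
Import numFieldNormedType.Exports.
Local Open Scope classical_set_scope.
Local Open Scope ring_scope.

(* Taking Z diagonal with eigenvalues 0, x, y decouples the arguments of the
   coefficient functions: for instance condition 6 becomes
   sum_i b_i(0) sum_j a_ij(x) psi_{2,j}(y) = 0 for all scalars x, y.
   Put G(x)_j = sum_i b_i(0) a_ij(x) for 2 <= j <= s - 1.  By conditions 3, 5, 9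
   the functional G(x) takes the values f_k(x) = sum_i b_i(0) c_i^k phi_k(c_i x),
   k = 2, 3, 4, on the vectors (c_j^(k-1) / (k-1)!)_j, and f_2, f_3, f_4 are
   linearly independent functions, so the G(x) span a space of dimension at
   least 3 inside a space of dimension s - 2 <= 4.  By conditions 6 and 10 they
   all annihilate psi_2(y) and psi_3(y), restricted to the stages 2..s-1, which
   therefore lie on a fixed line.  Let c_m = d be the first nonzero node.  As long
   as the nodes before stage i lie in {0, d}, the combination
   (d/2) psi_{2,i} - psi_{3,i} does not involve the a_ij: it is
   c_i^3 phi_3(c_i y) - (d/2) c_i^2 phi_2(c_i y).  Proportionality of the entries
   i and m then forces c_i in {0, d}.  Hence all nodes lie in {0, d, c_s}, so
   (c_i), (c_i^2), (c_i^3) are linearly dependent, and by conditions 1, 2, 4 so are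
   phi_2, phi_3, phi_4: a contradiction. *)

(** * Exponential polynomials *)

Lemma poly_nat_roots0 (K : numFieldType) (p : {poly K}) :
  (forall n : nat, p.[n%:R] = 0) -> p = 0.
Proof.
move=> p0; apply/eqP/negPn/negP => pn0.
suff : (size [seq i%:R : K | i <- iota 0 (size p)] < size p)%N.
  by rewrite size_map size_iota ltnn.
apply: max_poly_roots => //.
- by apply/allP => _ /mapP[i _ ->]; apply/rootP.
- rewrite map_inj_uniq ?iota_uniq// => i j /eqP.
  by rewrite eqr_nat => /eqP.
Qed.

(* Replacing [p r] by [r p(X+1) - r0 p] amounts to applying the difference
   operator E - r0: the degree of [p r0] drops, that of the others is kept. *)
Lemma exp_poly_free (K : numFieldType) (rs : seq K) (p : K -> {poly K}) :
  uniq rs -> {in rs, forall r, r != 0} ->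
  (forall n : nat, \sum_(r <- rs) (p r).[n%:R] * r ^+ n = 0) ->
  {in rs, forall r, p r = 0}.
Proof.
elim: rs p => [//|r0 rs IH] p /= /andP[r0rs urs] rsn0.
(* Inner induction on the size of [p r0]; once [p r0] is zero, the outer induction on the list of
   bases takes over. *)
have [N] := ubnP (size (p r0)).
have r0n0 : r0 != 0 by apply: rsn0; rewrite mem_head.
elim: N p => // N IHN p szN sum0.
have [p0|pn0] := eqVneq (p r0) 0.
  move=> r; rewrite inE => /predU1P[->//|]; move: r.
  apply: IH => // [r rrs|n]; first by apply: rsn0; rewrite inE rrs orbT.
  by have := sum0 n; rewrite big_cons p0 horner0 mul0r add0r.
pose q r := r *: (p r \Po ('X + 1)) - r0 *: p r.
have sizeS r : size (p r \Po ('X + 1)) = size (p r).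
  by rewrite -polyC1 size_comp_poly2// size_XaddC.
have lcS r : lead_coef (p r \Po ('X + 1)) = lead_coef (p r).
  rewrite -polyC1 lead_coef_comp ?size_XaddC//.
  by rewrite lead_coefDl ?lead_coefX ?expr1n ?mulr1// size_polyX size_polyC; case: eqP.
have q0 : {in r0 :: rs, forall r, q r = 0}.
  apply: IHN => [|n].
    rewrite /q -scalerBr; apply: (leq_ltn_trans (size_scale_leq _ _)).
    rewrite -ltnS; apply: leq_trans szN; rewrite ltnS.
    rewrite -(prednK (n := size (p r0))) ?size_poly_gt0//.
    apply/leq_sizeP => j; rewrite leq_eqVlt => /predU1P[<-|ltj].
      by rewrite coefB -{1}(sizeS r0) -!lead_coefE lcS subrr.
    rewrite prednK ?size_poly_gt0// in ltj.
    by rewrite coefB !nth_default ?subrr// ?sizeS.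
  transitivity (\sum_(r <- r0 :: rs) (p r).[n.+1%:R] * r ^+ n.+1
     - r0 * \sum_(r <- r0 :: rs) (p r).[n%:R] * r ^+ n).
    rewrite mulr_sumr -sumrB; apply: eq_bigr => r _.
    rewrite /q !hornerE horner_comp !hornerE -natr1 exprS /=; ring.
  by rewrite !sum0 mulr0 subrr.
(* For [r != r0] the top coefficient of [q r] is [r - r0] times that of [p r]. *)
have p0 : {in rs, forall r, p r = 0}.
  move=> r rrs; have : q r = 0 by apply: q0; rewrite inE rrs orbT.
  move=> /(congr1 (fun u : {poly K} => u`_(size (p r)).-1)).
  rewrite coefB !coefZ -{1}(sizeS r) -!lead_coefE lcS coef0 -mulrBl => /eqP.
  rewrite mulf_eq0 subr_eq0 lead_coef_eq0 => /orP[/eqP rE|/eqP//].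
  by move: r0rs; rewrite -rE rrs.
move=> r; rewrite inE => /predU1P[->|/p0//].
apply: poly_nat_roots0 => n.
have /eqP := sum0 n; rewrite big_cons big_seq big1 => [|j /p0 ->]; last first.
  by rewrite horner0 mul0r.
by rewrite addr0 mulf_eq0 expf_eq0 (negPf r0n0) andbF orbF => /eqP.
Qed.

(** Grouping equal nodes gives an exponential polynomial in which [p] sits at the base [rho t0 = 1].
    Freeness kills the total weight of every other node, and [h t0 = 0] discards the node [t0]. *)
Lemma exp_poly_eq_poly (K : numFieldType) (T : eqType) (I : eqType)
    (s : seq I) (rho : T -> K) (c : I -> T) (b : I -> K) (q p : {poly K})
    (t0 : T) :
  injective rho -> (forall t, rho t != 0) -> rho t0 = 1 -> q != 0 ->
  (forall n : nat, q.[n%:R] * (\sum_(i <- s) b i * rho (c i) ^+ n) = p.[n%:R]) ->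
  forall h : T -> K, h t0 = 0 -> \sum_(i <- s) b i * h (c i) = 0.
Proof.
move=> rhoI rho0 rhot0 qn0 qp h h0.
(* [t0] is added to the nodes so that the base 1 is present to carry [p]. *)
pose ts := undup (t0 :: map c s).
pose B t := \sum_(i <- s | c i == t) b i.
(* [exp_poly_free] indexes its polynomials by the bases, so [rho] has to be inverted on [ts]; 0 is a
   default off the image. *)
pose w r := if [pick i : 'I_(size ts) | rho (nth t0 ts i) == r] is Some i
  then B (nth t0 ts i) *: q - (r == 1)%:R *: p else 0.
have group (f : T -> K) : \sum_(i <- s) b i * f (c i) = \sum_(t <- ts) B t * f t.
  under [RHS]eq_bigr do rewrite mulr_suml.
  under [RHS]eq_bigr do rewrite big_mkcond.
  rewrite exchange_big /= big_seq [RHS]big_seq; apply: eq_bigr => i si.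
  have cits : c i \in ts by rewrite mem_undup inE map_f ?orbT.
  rewrite (bigD1_seq (c i)) ?undup_uniq//= eqxx big1 ?addr0// => t.
  by rewrite eq_sym => /negPf ->.
have uts : uniq ts by exact: undup_uniq.
have wE t : t \in ts -> w (rho t) = B t *: q - (t == t0)%:R *: p.
  move=> tts; rewrite /w; case: pickP => [i /eqP/rhoI ->|].
    by rewrite -rhot0 (inj_eq rhoI).
  by move: (tts); rewrite -index_mem => lt /(_ (Ordinal lt)); rewrite /= nth_index ?eqxx.
have w0 : {in map rho ts, forall r, w r = 0}.
  apply: exp_poly_free; first by rewrite map_inj_uniq.
    by move=> _ /mapP[t _ ->].
  move=> n; rewrite big_map big_seq.
  under eq_bigr => t tts do rewrite (wE _ tts) !hornerE mulrBl.
  rewrite sumrB -!big_seq [X in _ - X](bigD1_seq t0) ?mem_undup ?mem_head//=.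
  rewrite eqxx rhot0 mul1r expr1n mulr1.
  rewrite [X in _ - (_ + X)]big1 ?addr0; last by move=> t /negPf ->; rewrite !mul0r.
  rewrite -qp (group (fun t => rho t ^+ n)) mulr_sumr -sumrB big1// => t _; ring.
rewrite group big_seq big1// => t tts.
have [->|tt0] := eqVneq t t0; first by rewrite h0 mulr0.
have := w0 (rho t) (map_f _ tts).
rewrite wE// (negPf tt0) scale0r subr0 => /eqP.
by rewrite scaler_eq0 (negPf qn0) orbF => /eqP ->; rewrite mul0r.
Qed.

(** * The functions phi_k at real arguments *)

Lemma emb_is_zmod_morphism (R : realType) (F : scalars) :
  zmod_morphism (@emb R F).
Proof. by case: F => // x y /=; rewrite rmorphB. Qed.

Lemma emb_is_monoid_morphism (R : realType) (F : scalars) :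
  monoid_morphism (@emb R F).
Proof. by case: F => //; split => [|x y] /=; rewrite ?rmorph1 ?rmorphM. Qed.

HB.instance Definition _ (R : realType) (F : scalars) :=
  GRing.isZmodMorphism.Build R (field_of R F) (@emb R F)
    (@emb_is_zmod_morphism R F).
HB.instance Definition _ (R : realType) (F : scalars) :=
  GRing.isMonoidMorphism.Build R (field_of R F) (@emb R F)
    (@emb_is_monoid_morphism R F).

Lemma emb_norm (R : realType) (F : scalars) (x : R) :
  `|emb F x| = emb F `|x|.
Proof. by case: F => //=; rewrite normc_def/= expr0n/= addr0 sqrtr_sqr. Qed.

Lemma emb_lt (R : realType) (F : scalars) (x y : R) :
  (emb F x < emb F y) = (x < y).
Proof. by case: F => //=; rewrite ltcR. Qed.

(** Positive elements of [R[i]] are real, so every epsilon in [field_of R F] comes from [R]. *)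
Lemma gt0_emb (R : realType) (F : scalars) (e : field_of R F) :
  0 < e -> exists2 d : R, 0 < d & emb F d = e.
Proof.
case: F e => /= [e e0|[a b]]; first by exists e.
by rewrite ltcE/= => /andP[/eqP -> a0]; exists a.
Qed.

Lemma emb_cvg (R : realType) (F : scalars) (u : R^nat) (l : R) :
  u @ \oo --> l -> (fun n => emb F (u n)) @ \oo --> emb F l.
Proof.
move=> /cvgrPdist_lt ul; apply/cvgrPdist_lt => _ /gt0_emb[e e0 <-].
near=> n; rewrite -rmorphB emb_norm emb_lt; near: n; exact: ul.
Unshelve. all: by end_near. Qed.

Lemma expm_scalar (R : realType) (F : scalars) (x : R) (i j : 'I_1) :
  expm (emb F x)%:M i j = emb F (expR x).
Proof.
rewrite !ord1 mxE; apply: cvg_lim; first exact: norm_hausdorff.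
have -> : series (fun m => ((emb F x)%:M ^+ m : 'M[field_of R F]_1) 0 0 / m`!%:R)
    = fun n => emb F (series (exp_coeff x) n).
  apply/funext => n; rewrite /series/= rmorph_sum; apply: eq_bigr => m _.
  by rewrite -rmorphXn/= mxE mulr1n fmorph_div rmorphXn rmorph_nat.
apply: emb_cvg; exact: is_cvg_series_exp_coeff.
Qed.

Lemma int01_emb (R : realType) (F : scalars) (f : R -> R) :
  int01 (fun t => emb F (f t))
  = emb F (\int[lebesgue_measure]_(t in `[0%R, 1%R]) f t).
Proof.
case: F => //=; congr (_ +i* _)%C.
by rewrite /Rintegral integral0.
Qed.

Definition phis (R : realType) (F : scalars) (k : nat) (x : field_of R F) :
  field_of R F := phi k (x%:M : 'M[field_of R F]_1) 0 0.

(** This is phi_k for [k >= 1] only: at [k = 0] the truncated predecessor repeats phi_1. *)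
Definition phir (R : realType) (k : nat) (x : R) : R :=
  \int[lebesgue_measure]_(t in `[0%R, 1%R])
     (expR ((1 - t) * x) * (t ^+ k.-1 / k.-1`!%:R)).

Lemma phis_emb (R : realType) (F : scalars) (k : nat) (x : R) :
  phis k.+1 (emb F x) = emb F (phir k.+1 x).
Proof.
rewrite /phis mxE -int01_emb.
congr (int01 _); apply/funext => t.
by rewrite scale_scalar_mx -rmorphM expm_scalar -rmorphM.
Qed.

(** * Integration over the unit interval and the recurrence of the phi_k *)

Lemma is_derive_continuous (R : realType) (f g : R -> R) :
  (forall t : R, is_derive t 1 g (f t)) -> continuous g.
Proof.
by move=> dg t; apply/differentiable_continuous/derivable1_diffP; case: (dg t).
Qed.

Lemma int01_FTC (R : realType) (f g : R -> R) :
  continuous f -> (forall t : R, is_derive t 1 g (f t)) ->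
  \int[lebesgue_measure]_(t in `[0%R, 1%R]) f t = g 1 - g 0.
Proof.
move=> cf dg; have cg := is_derive_continuous dg.
rewrite /Rintegral (@continuous_FTC2 _ f g)//.
- exact: continuous_subspaceT.
- split => [t _||]; first by case: (dg t).
  + by apply: cvg_at_right_filter; exact: cg.
  + by apply: cvg_at_left_filter; exact: cg.
- by move=> t _; rewrite derive1E; case: (dg t).
Qed.

Lemma continuous_integrable01 (R : realType) (f : R -> R) :
  continuous f -> lebesgue_measure.-integrable `[0%R, 1%R] (EFin \o f).
Proof.
move=> cf; apply: continuous_compact_integrable; first exact: segment_compact.
exact: continuous_subspaceT.
Qed.

Lemma is_derive_expR_subl (R : realType) (x t : R) :
  is_derive t 1 (fun t => expR ((1 - t) * x)) (expR ((1 - t) * x) * - x).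
Proof.
apply: is_derive1_comp.
rewrite (_ : (fun t => (1 - t) * x) = (cst 1 - id) * cst x)//.
by apply: is_derive_eq; rewrite /GRing.scale/= mulr0; ring.
Qed.

Lemma is_derive_expn_fact (R : realType) (k : nat) (t : R) :
  is_derive t 1 (fun t : R => t ^+ k.+1 / k.+1`!%:R) (t ^+ k / k`!%:R).
Proof.
rewrite (_ : (fun t => _) = (id ^+ k.+1) * cst k.+1`!%:R^-1); last first.
  by apply/funext => u; rewrite /GRing.mul/= fctE.
apply: is_derive_eq.
rewrite /GRing.scale /= factS natrM.
have k0 : k`!%:R != 0 :> R by rewrite pnatr_eq0 -lt0n fact_gt0.
have k1 : k.+1%:R != 0 :> R by rewrite pnatr_eq0.
rewrite mulr0.
by field; rewrite k0 /= addrC natr1.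
Qed.

(** Integration by parts: the derivative of exp((1 - t) x) t^(k+1) / (k+1)! is integrated over
    [0, 1]. *)
Lemma phir_rec (R : realType) (k : nat) (x : R) :
  phir k.+1 x = x * phir k.+2 x + 1 / k.+1`!%:R.
Proof.
pose e t := expR ((1 - t) * x).
pose f k (t : R) := e t * (t ^+ k / k`!%:R).
have ce : continuous e := is_derive_continuous (is_derive_expR_subl x).
have cf k' : continuous (f k').
  move=> t; apply: (continuousM (ce t)).
  exact: (continuousM (@exprn_continuous R k' t) (@cst_continuous _ _ _ t)).
have dfk (t : R) : is_derive t 1 (f k.+1) (f k t - x * f k.+1 t).
  apply: is_derive_eq.
    apply: (is_deriveM (is_derive_expR_subl x t) (is_derive_expn_fact k t)).
  rewrite /f /e /GRing.scale/=. ring.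
have cxf : continuous (fun t => x * f k.+1 t).
  by move=> t; apply: continuousM; [exact: cst_continuous|exact: cf].
have cdf : continuous (fun t => f k t - x * f k.+1 t).
  by move=> t; apply: continuousB; [exact: cf|exact: cxf].
have := int01_FTC cdf dfk.
rewrite RintegralB//; try exact: continuous_integrable01.
rewrite RintegralZl//=; last exact: continuous_integrable01.
rewrite -[X in X - _]/(phir k.+1 x) -[X in _ * X]/(phir k.+2 x) => /eqP.
rewrite subr_eq => /eqP ->; rewrite addrC; congr +%R.
rewrite /f /e subrr mul0r expR0 expr1n expr0n /=. ring.
Qed.

(** The factor [x] stays on the left, so that zero arguments need no separate treatment. *)
Lemma phir1 (R : realType) (x : R) : x * phir 1 x = expR x - 1.
Proof.
pose e t := expR ((1 - t) * x).
have ce : continuous e := is_derive_continuous (is_derive_expR_subl x).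
have ce' : continuous (fun t => e t * - x).
  by move=> t; apply: continuousM; [exact: ce|exact: cst_continuous].
have := int01_FTC ce' (is_derive_expR_subl x).
rewrite RintegralZr//; last exact: continuous_integrable01.
rewrite /= subrr mul0r expR0 subr0 mul1r.
have -> : phir 1 x = \int[lebesgue_measure]_(t in `[0%R, 1%R]) e t.
  by apply: eq_Rintegral => t _; rewrite /= expr0 divr1 mulr1.
by rewrite mulrN mulrC => /eqP; rewrite eqr_oppLR opprB => /eqP.
Qed.

Lemma phir2 (R : realType) (x : R) : x ^+ 2 * phir 2 x = expR x - 1 - x.
Proof. by rewrite -phir1 (phir_rec 0) (_ : 1`! = 1%N)//; field. Qed.

Lemma phir3 (R : realType) (x : R) :
  x ^+ 3 * phir 3 x = expR x - 1 - x - x ^+ 2 / 2.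
Proof. by rewrite -phir2 (phir_rec 1) (_ : 2`! = 2%N)//; field. Qed.

Lemma phir4 (R : realType) (x : R) :
  x ^+ 4 * phir 4 x = expR x - 1 - x - x ^+ 2 / 2 - x ^+ 3 / 6.
Proof. by rewrite -phir3 (phir_rec 2) (_ : 3`! = 6%N)//; field. Qed.

Lemma phir2_0 (R : realType) : phir 2 (0 : R) = 1 / 2.
Proof. by rewrite (phir_rec 1) (_ : 2`! = 2%N)// mul0r add0r. Qed.

Lemma emb_inj (R : realType) (F : scalars) : injective (@emb R F).
Proof. exact: fmorph_inj. Qed.

(** * Linear independence of phi_2, phi_3 and phi_4 *)

Section PhiScalar.
Variables (R : realType) (F : scalars).
Implicit Types (x : R).
Local Notation K := (field_of R F).
Local Notation emb := (@emb R F).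

Lemma phis2 x :
  emb x ^+ 2 * phis 2 (emb x) = emb (expR x) - 1 - emb x.
Proof.
by rewrite phis_emb -rmorphXn -rmorphM phir2 !rmorphB rmorph1.
Qed.

Lemma phis3 x :
  emb x ^+ 3 * phis 3 (emb x) = emb (expR x) - 1 - emb x - emb x ^+ 2 / 2.
Proof.
rewrite phis_emb -rmorphXn -rmorphM phir3 !rmorphB rmorph1 fmorph_div.
by rewrite rmorphXn rmorph_nat.
Qed.

Lemma phis4 x :
  emb x ^+ 4 * phis 4 (emb x)
  = emb (expR x) - 1 - emb x - emb x ^+ 2 / 2 - emb x ^+ 3 / 6.
Proof.
rewrite phis_emb -rmorphXn -rmorphM phir4 !rmorphB rmorph1 !fmorph_div.
by rewrite !rmorphXn !rmorph_nat.
Qed.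

Lemma phis2_0 : phis 2 (0 : K) = 1 / 2.
Proof.
by rewrite -(rmorph0 emb) phis_emb phir2_0 fmorph_div rmorph1 rmorph_nat.
Qed.

(* Multiplying by [n ^ 4] turns the hypothesis into an identity between an
   exponential polynomial and a polynomial. *)
Lemma phis_free (I : eqType) (r : seq I) (b : I -> K) (c : I -> R)
    (alpha beta gamma : K) :
  [|| alpha != 0, beta != 0 | gamma != 0] ->
  (forall n : nat,
    \sum_(i <- r) b i *
      (alpha * (emb (c i) ^+ 2 * phis 2 (emb (c i) * n%:R))
       + beta * (emb (c i) ^+ 3 * phis 3 (emb (c i) * n%:R))
       + gamma * (emb (c i) ^+ 4 * phis 4 (emb (c i) * n%:R))) = 0) ->
  forall h : R -> K, h 0 = 0 -> \sum_(i <- r) b i * h (c i) = 0.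
Proof.
move=> abc0 sum0.
(* After multiplication by [n ^ 4], [q] is the factor of exp(c_i n), and [p i] collects the
   polynomial terms with the opposite sign. *)
pose q : {poly K} := gamma%:P + beta *: 'X + alpha *: 'X^2.
pose p i : {poly K} :=
  alpha *: ('X^2 * (1 + emb (c i) *: 'X))
  + beta *: ('X * (1 + emb (c i) *: 'X + (emb (c i) ^+ 2 / 2) *: 'X^2))
  + gamma *: (1 + emb (c i) *: 'X + (emb (c i) ^+ 2 / 2) *: 'X^2
              + (emb (c i) ^+ 3 / 6) *: 'X^3).
apply: (@exp_poly_eq_poly _ _ _ _ (emb \o @expR R) _ _ q
          (\sum_(i <- r) b i *: p i)).
- by apply: inj_comp; [exact: emb_inj|exact: expR_inj].
- by move=> t; rewrite /= fmorph_eq0 gt_eqF ?expR_gt0.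
- by rewrite /= expR0 rmorph1.
- apply: contraTneq abc0 => q0.
  have qE i : q`_i = 0 by rewrite q0 coef0.
  have := (qE 0%N, qE 1%N, qE 2%N).
  rewrite !coefD !coefZ !coefC !coefX !coefXn /= !mulr0 !mulr1 !addr0 !add0r.
  by move=> [[-> ->] ->]; rewrite eqxx.
- move=> n; rewrite horner_sum mulr_sumr.
  apply/eqP; rewrite -subr_eq0 -sumrB.
  apply/eqP/(etrans _ (mulr0 (n%:R ^+ 4))).
  rewrite -[X in _ = _ * X](sum0 n) mulr_sumr; apply: eq_bigr => i _.
  pose x := c i * n%:R.
  have xE : emb (c i) * n%:R = emb x by rewrite rmorphM rmorph_nat.
  have eE : emb (expR (c i)) ^+ n = emb (expR x).
    by rewrite expRM_natr rmorphXn.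
  rewrite /q /p !hornerE /= eE xE.
  have := (phis2 x, phis3 x, phis4 x); rewrite -xE => -[[h2 h3] h4].
  transitivity (b i * (
      alpha * n%:R ^+ 2 * (emb (expR x) - 1 - emb (c i) * n%:R)
      + beta * n%:R * (emb (expR x) - 1 - emb (c i) * n%:R
                       - (emb (c i) * n%:R) ^+ 2 / 2)
      + gamma * (emb (expR x) - 1 - emb (c i) * n%:R
                 - (emb (c i) * n%:R) ^+ 2 / 2
                 - (emb (c i) * n%:R) ^+ 3 / 6))).
    by field.
  rewrite -h4 -h3 -h2; ring.
Qed.
End PhiScalar.

(** * Functions of diagonal matrices *)

Section Diagonal.
Variables (R : realType) (F : scalars).
Local Notation K := (field_of R F).

Lemma scale_diag_mx n (x : K) (d : 'rV[K]_n) :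
  x *: diag_mx d = diag_mx (x *: d).
Proof. by rewrite linearZ. Qed.

Lemma exp_diag_mx n (d : 'rV[K]_n) (m : nat) :
  diag_mx d ^+ m = diag_mx (map_mx (fun x => x ^+ m) d).
Proof.
elim: m => [|m IH].
  by apply/matrixP => i j; rewrite !mxE expr0.
rewrite exprS IH -[_ * _]/(_ *m _) mulmx_diag; congr diag_mx.
by apply/rowP => i; rewrite !mxE exprS.
Qed.

Lemma expm_diag n (d : 'rV[K]_n) i j :
  expm (diag_mx d) i j = expm ((d 0 i)%:M : 'M[K]_1) 0 0 *+ (i == j).
Proof.
rewrite !mxE.
have [->|ij] := eqVneq i j.
  rewrite mulr1n; congr (limn (series _)); apply/funext => m.
  by rewrite exp_diag_mx -diag_const_mx exp_diag_mx !mxE !eqxx.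
rewrite mulr0n; apply: cvg_lim; first exact: norm_hausdorff.
rewrite (_ : series _ = fun=> 0); first exact: cvg_cst.
apply/funext => N; rewrite /series/= big1// => m _.
by rewrite exp_diag_mx !mxE (negPf ij) mulr0n mul0r.
Qed.

Lemma int01_0 : @int01 R F (fun=> 0) = 0.
Proof.
rewrite -[in LHS](rmorph0 (@emb R F)) (int01_emb F (fun=> 0)).
by rewrite /Rintegral integral0 rmorph0.
Qed.

Lemma phi_diag k n (d : 'rV[K]_n) i j :
  phi k (diag_mx d) i j = phis k (d 0 i) *+ (i == j).
Proof.
case: k => [|k]; first exact: expm_diag.
rewrite /phis !mxE.
have [<-|ij] := eqVneq i j.
  rewrite mulr1n; congr (int01 _); apply/funext => t.
  congr (_ * _).
  by rewrite scale_diag_mx expm_diag eqxx mulr1n [(_ *: d) 0 i]mxE scale_scalar_mx.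
rewrite mulr0n -int01_0; congr (int01 _); apply/funext => t.
by rewrite scale_diag_mx expm_diag (negPf ij) mulr0n mul0r.
Qed.

Definition scalar_of (f : forall n, 'M[K]_n -> 'M[K]_n) (x : K) : K :=
  f 1%N x%:M 0 0.

Definition diagonal (f : forall n, 'M[K]_n -> 'M[K]_n) : Prop :=
  forall n (d : 'rV[K]_n), f n (diag_mx d) = diag_mx (map_mx (scalar_of f) d).

(** The form of the coefficient functions enters the argument here: each phi_k acts entrywise on
    diagonal matrices, and scaling and linear combinations preserve this. *)
Lemma phi_comb_diagonal s c (f : forall n, 'M[K]_n -> 'M[K]_n) :
  phi_comb s c f -> diagonal f.
Proof.
move=> [p [al [be fE]]] n d; apply/matrixP => i j.
have phi1 k x : phi k (x%:M : 'M[K]_1) 0 0 = phis k x by [].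
rewrite !mxE /scalar_of !fE !mxE !summxE mulrnDl -!sumrMnl.
congr (_ + _); apply: eq_bigr => k _.
  by rewrite !mxE phi_diag mulrnAr.
rewrite !summxE -sumrMnl; apply: eq_bigr => l _.
by rewrite scale_scalar_mx !mxE scale_diag_mx phi_diag mxE mulrnAr.
Qed.
End Diagonal.

(** * The linear algebra of the order conditions *)

(* A nontrivial relation between the columns [w2], [w3], [w4], [u], [v] exists
   as [m < 5]; applying the functionals [G x] and using that [G x] takes
   independent values on the first three kills their coefficients. *)
Lemma annihilated_minor0 (K : fieldType) (T : Type) (m : nat)
    (G : T -> 'I_m -> K) (w2 w3 w4 u v : 'I_m -> K) :
  (m < 5)%N ->
  (forall x, \sum_j G x j * u j = 0) ->
  (forall x, \sum_j G x j * v j = 0) ->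
  (forall al be ga : K,
    (forall x, al * (\sum_j G x j * w2 j) + be * (\sum_j G x j * w3 j)
               + ga * (\sum_j G x j * w4 j) = 0) ->
    [/\ al = 0, be = 0 & ga = 0]) ->
  forall i j, u i * v j = u j * v i.
Proof.
move=> m5 Gu Gv free i j.
pose W : 'M[K]_(5, m) :=
  \matrix_(k, j) nth (u j) [:: w2 j; w3 j; w4 j; v j; u j] k.
have : kermx W != 0.
  by rewrite -mxrank_eq0 mxrank_ker subn_eq0 -ltnNge (leq_ltn_trans (rank_leq_col _)).
move=> /rowV0Pn[z /sub_kermxP zW z0].
have rel k : z 0 0 * w2 k + z 0 1 * w3 k + z 0 2 * w4 k
             + z 0 3 * v k + z 0 4 * u k = 0.
  have /rowP/(_ k) := zW; rewrite !mxE.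
  do 5 rewrite big_ord_recl; rewrite big_ord0 !mxE /= addr0 !addrA => <-.
  by congr (z _ _ * _ + z _ _ * _ + z _ _ * _ + z _ _ * _ + z _ _ * _);
    apply/val_inj.
have [|z00 z01 z02] := free (z 0 0) (z 0 1) (z 0 2).
  have comb (g a0 a1 a2 a3 a4 b0 b1 b2 b3 b4 : K) :
      a0 * (g * b0) + a1 * (g * b1) + a2 * (g * b2)
      = g * (a0 * b0 + a1 * b1 + a2 * b2 + a3 * b3 + a4 * b4)
        - a3 * (g * b3) - a4 * (g * b4) by ring.
  move=> x; transitivity (\sum_k G x k * (z 0 0 * w2 k + z 0 1 * w3 k
      + z 0 2 * w4 k + z 0 3 * v k + z 0 4 * u k)
      - z 0 3 * (\sum_k G x k * v k) - z 0 4 * (\sum_k G x k * u k)).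
    rewrite !mulr_sumr -!sumrB -!big_split /=; apply: eq_bigr => k _; exact: comb.
  by rewrite Gu Gv !mulr0 !subr0 big1// => k _; rewrite rel mulr0.
have uv k : z 0 3 * v k = - z 0 4 * u k.
  have /eqP := rel k; rewrite z00 z01 z02 !mul0r !add0r addr_eq0 mulNr.
  by move/eqP.
(* The relation left between [v] and [u] is nontrivial: either [u] vanishes or [v] is a multiple of
   [u]. *)
have [z3|z3] := eqVneq (z 0 3) 0.
  have z4 : z 0 4 != 0.
    apply: contra z0 => /eqP z4; apply/eqP/rowP => k; rewrite mxE.
    case: k => [[|[|[|[|[|//]]]]] lt].
    - by rewrite -[RHS]z00; congr (z _ _); apply/val_inj.
    - by rewrite -[RHS]z01; congr (z _ _); apply/val_inj.
    - by rewrite -[RHS]z02; congr (z _ _); apply/val_inj.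
    - by rewrite -[RHS]z3; congr (z _ _); apply/val_inj.
    - by rewrite -[RHS]z4; congr (z _ _); apply/val_inj.
  have u0 k : u k = 0.
    have := uv k; rewrite z3 mul0r => /esym/eqP.
    by rewrite mulf_eq0 oppr_eq0 (negPf z4) => /eqP.
  by rewrite !u0 !mul0r.
apply: (mulfI z3); transitivity (u i * (z 0 3 * v j)); first ring.
transitivity (u j * (z 0 3 * v i)); last ring.
rewrite !uv; ring.
Qed.

(** As j < i <= s, the index [j] stops at [s - 1]; hence the functionals G(x) live in dimension
    [s - 2]. *)
Lemma exchange_lower_triangle (V : nmodType) (s : nat) (f : nat -> nat -> V) :
  \sum_(2 <= i < s.+1) \sum_(2 <= j < i) f i j
  = \sum_(2 <= j < s) \sum_(2 <= i < s.+1 | (j < i)%N) f i j.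
Proof.
rewrite big_nat (eq_bigr (fun i => \sum_(2 <= j < s | (j < i)%N) f i j)).
  by rewrite -big_nat (exchange_big_dep_nat xpredT).
by move=> i /andP[_ lt]; rewrite (big_nat_widen 2 i s)// -ltnS.
Qed.

(** * The order conditions at scalar arguments *)

Section ScalarMethod.
Variables (R : realType) (F : scalars) (s : nat).
Local Notation K := (field_of R F).
Local Notation emb := (@emb R F).
Variables (c : nat -> R) (b0 : nat -> K) (a : nat -> nat -> K -> K).

Definition psis (j i : nat) (x : K) : K :=
  \sum_(2 <= k < i) (emb (c k) ^+ j.-1 / (j.-1)`!%:R) * a i k x
  - emb (c i) ^+ j * phis j (emb (c i) * x).

Definition two_node_psi (d : R) (y : R) (x : K) : K :=
  emb y ^+ 3 * phis 3 (emb y * x) - emb d / 2 * (emb y ^+ 2 * phis 2 (emb y * x)).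

(** For nodes in {0, d}, c_k^2 / 2 = (d / 2) c_k, so the terms in a_ik cancel. *)
Lemma psis_two_node (d : R) (i : nat) (x : K) :
  (forall k, (2 <= k < i)%N -> c k = 0 \/ c k = d) ->
  emb d / 2 * psis 2 i x - psis 3 i x = two_node_psi d (c i) x.
Proof.
move=> ck; rewrite /psis /two_node_psi.
rewrite /= (_ : 1`! = 1%N)// (_ : 2`! = 2%N)//.
have -> : \sum_(2 <= k < i) emb (c k) ^+ 2 / 2 * a i k x
  = emb d / 2 * \sum_(2 <= k < i) emb (c k) / 1 * a i k x.
  rewrite mulr_sumr !big_nat; apply: eq_bigr => k /ck[->|->].
    by rewrite rmorph0 expr0n /= !mul0r mulr0.
  by field.
by ring.
Qed.

Hypothesis s6 : (s <= 6)%N.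
Hypothesis b0c : \sum_(2 <= i < s.+1) b0 i * emb (c i) != 0.
Hypothesis b0psi : forall j, (2 <= j <= 4)%N ->
  forall x, \sum_(2 <= i < s.+1) b0 i * psis j i x = 0.
Hypothesis b0apsi : forall k, (2 <= k <= 3)%N -> forall x y,
  \sum_(2 <= i < s.+1) b0 i * (\sum_(2 <= j < i) a i j x * psis k j y) = 0.

(** The values of the combination at [x] and at [y], as vectors over the stages, are annihilated by
    all G(z) and so are parallel; this is their minor in rows [i] and [j]. *)
Lemma psis_minor0 (al be : K) (i j : nat) (p q : K -> K) :
  (2 <= i < s)%N -> (2 <= j < s)%N ->
  (forall x, al * psis 2 i x + be * psis 3 i x = p x) ->
  (forall x, al * psis 2 j x + be * psis 3 j x = q x) ->
  forall x y, p x * q y = q x * p y.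
Proof.
move=> /andP[i2 si] /andP[j2 sj] pE qE x y; rewrite -!pE -!qE.
pose G z (k : nat) := \sum_(2 <= l < s.+1 | (k < l)%N) b0 l * a l k z.
(* The ordinals below [s - 2] stand for the stages 2 to s - 1, hence the shift by 2. *)
have GE z (w : nat -> K) :
    \sum_(k < s - 2) G z (k + 2)%N * w (k + 2)%N
    = \sum_(2 <= l < s.+1) b0 l * (\sum_(2 <= k < l) a l k z * w k).
  rewrite -(big_mkord xpredT (fun k => G z (k + 2)%N * w (k + 2)%N)).
  rewrite -(big_addn 0 s 2 xpredT (fun k => G z k * w k)).
  under [RHS]eq_bigr do rewrite mulr_sumr.
  rewrite exchange_lower_triangle; apply: eq_bigr => k _.
  by rewrite mulr_suml; apply: eq_bigr => l _; rewrite mulrA.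
pose w k (l : nat) : K := emb (c l) ^+ k.-1 / (k.-1)`!%:R.
pose f k z := \sum_(2 <= i < s.+1) b0 i * (emb (c i) ^+ k * phis k (emb (c i) * z)).
have Gw k z : (2 <= k <= 4)%N ->
    \sum_(l < s - 2) G z (l + 2)%N * w k (l + 2)%N = f k z.
  move=> k24; rewrite GE; apply/eqP; rewrite -subr_eq0 -sumrB; apply/eqP.
  apply: etrans (b0psi k24 z); apply: eq_bigr => l _; rewrite -mulrBr /psis; congr (_ * (_ - _)).
  by apply: eq_bigr => k' _; rewrite mulrC.
have Gpsi z y' : \sum_(k < s - 2) G z (k + 2)%N *
    (al * psis 2 (k + 2) y' + be * psis 3 (k + 2) y') = 0.
  rewrite (GE z (fun k => al * psis 2 k y' + be * psis 3 k y')).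
  transitivity (al * \sum_(2 <= i < s.+1) b0 i * (\sum_(2 <= j < i) a i j z * psis 2 j y')
     + be * \sum_(2 <= i < s.+1) b0 i * (\sum_(2 <= j < i) a i j z * psis 3 j y')).
    rewrite !mulr_sumr -big_split; apply: eq_bigr => l _ /=.
    rewrite !mulr_sumr -big_split; apply: eq_bigr => k _ /=.
    ring.
  by rewrite !b0apsi// !mulr0 addr0.
have i' : (i - 2 < s - 2)%N by lia.
have j' : (j - 2 < s - 2)%N by lia.
have ei : (Ordinal i' + 2)%N = i by rewrite /= subnK.
have ej : (Ordinal j' + 2)%N = j by rewrite /= subnK.
rewrite -ei -ej.
apply: (@annihilated_minor0 K K (s - 2) (fun z k => G z (k + 2)%N)
  (fun k => w 2%N (k + 2)%N) (fun k => w 3%N (k + 2)%N) (fun k => w 4%N (k + 2)%N)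
  (fun k => al * psis 2 (k + 2) x + be * psis 3 (k + 2) x)
  (fun k => al * psis 2 (k + 2) y + be * psis 3 (k + 2) y)).
- by lia.
- by move=> z; exact: Gpsi.
- by move=> z; exact: Gpsi.
move=> al' be' ga' abg.
have [abg0|] := boolP [|| al' != 0, be' != 0 | ga' != 0]; last first.
  by rewrite !negb_or !negbK => /and3P[/eqP -> /eqP -> /eqP ->].
(* A nontrivial relation between f_2, f_3, f_4, tested with [h = emb], would contradict [b0c]. *)
case/eqP: b0c; apply: (phis_free (c := c) abg0 _ (rmorph0 emb)) => n.
apply: etrans (abg n%:R); rewrite !Gw// /f !mulr_sumr -!big_split.
apply: eq_bigr => l _ /=; ring.
Qed.

(** Freeness for the single node [d], with coefficients -d/2, 1, 0. *)
Lemma two_node_psi_neq0 (d : R) : d != 0 ->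
  exists n : nat, two_node_psi d d n%:R != 0.
Proof.
move=> d0; apply: contrapT => /forallNP h.
have abc0 : [|| - (emb d / 2) != 0, (1 : K) != 0 | (0 : K) != 0].
  by rewrite oner_eq0 orbT.
suff : \sum_(i <- [:: tt]) 1 * emb d = 0.
  by rewrite big_seq1 mul1r => /eqP; rewrite fmorph_eq0 (negPf d0).
apply: (phis_free (b := fun=> 1) (c := fun=> d) abc0 _ (rmorph0 emb)) => n.
have /negP/negPn/eqP hn := h n.
by rewrite big_seq1 mul1r; apply: etrans hn; rewrite /two_node_psi; ring.
Qed.

(** The second conjunct serves the induction: when [d] is nonzero, it supplies an earlier stage with
    node [d] to compare with stage [m]. *)
Lemma two_nodes (m : nat) : (m <= s)%N -> exists d : R,
  (forall k, (2 <= k < m)%N -> c k = 0 \/ c k = d) /\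
  (d = 0 \/ exists2 k, (2 <= k < m)%N & c k = d).
Proof.
elim: m => [|m IH] ms; first by exists 0; split; [move=> k; lia|left].
have [d [ckd dE]] := IH (ltnW ms).
have [m2|m2] := ltnP m 2; first by exists 0; split; [move=> k; lia|left].
have [cm0|cm0] := eqVneq (c m) 0.
  exists d; split.
    move=> k /andP[k2]; rewrite ltnS leq_eqVlt => /predU1P[->|km]; first by left.
    by apply: ckd; rewrite k2.
  case: dE => [|[k km <-]]; first by left.
  by right; exists k => //; lia.
have [d0|d0] := eqVneq d 0.
  exists (c m); split; last by right; exists m; [lia|].
  move=> k /andP[k2]; rewrite ltnS leq_eqVlt => /predU1P[->|km]; first by right.
  left; have : c k = 0 \/ c k = d by apply: ckd; rewrite k2.
  by rewrite d0 => -[].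
case: dE => [/eqP|[l lm cl]]; first by rewrite (negPf d0).
have [cmd|cmd] := eqVneq (c m) d.
  exists d; split; last by right; exists m; [lia|].
  move=> k /andP[k2]; rewrite ltnS leq_eqVlt => /predU1P[->|km]; first by right.
  by apply: ckd; rewrite k2.
have [n0 Hn0] := two_node_psi_neq0 d0.
have psil x : emb d / 2 * psis 2 l x + (-1) * psis 3 l x = two_node_psi d d x.
  by rewrite mulN1r psis_two_node ?cl// => k kl; apply: ckd; lia.
have psim x : emb d / 2 * psis 2 m x + (-1) * psis 3 m x = two_node_psi d (c m) x.
  by rewrite mulN1r psis_two_node.
(* Freezing one argument of the minor at [n0] turns it into proportionality with constant
   factors. *)
have [P [Q [P0 minor]]] : exists P Q : K, P != 0 /\
    forall n : nat, P * two_node_psi d (c m) n%:R = Q * two_node_psi d d n%:R.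
  exists (two_node_psi d d n0%:R), (two_node_psi d (c m) n0%:R).
  split; first exact: Hn0.
  have ls : (2 <= l < s)%N by lia.
  have mss : (2 <= m < s)%N by lia.
  by move=> n; exact: (psis_minor0 ls mss psil psim n0%:R n%:R).
pose bb t := if t then P else - Q.
pose cc (t : bool) := if t then c m else d.
have abc0 : [|| - (emb d / 2) != 0, (1 : K) != 0 | (0 : K) != 0].
  by rewrite oner_eq0 orbT.
case/eqP: P0.
(* The test function is the indicator of [c m], which vanishes at 0 and at [d]; freeness then yields
   [P = 0]. *)
transitivity (\sum_(t <- [:: true; false]) bb t * (cc t == c m)%:R).
  by rewrite !big_cons big_nil /= eqxx [d == _]eq_sym (negPf cmd) mulr0 mulr1 !addr0.
apply: (phis_free (c := cc) abc0 _ (h := fun t => (t == c m)%:R)); last first.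
  by rewrite eq_sym (negPf cm0).
move=> n; rewrite !big_cons big_nil /=.
have /eqP := minor n; rewrite -subr_eq0 => /eqP; apply: etrans.
rewrite /two_node_psi /=; move: (@phis R F 2) (@phis R F 3) (@phis R F 4) => f2 f3 f4.
ring.
Qed.

Lemma no_scalar_method (b : nat -> K -> K) :
  ~ [/\ forall x, \sum_(2 <= i < s.+1) emb (c i) * b i x = phis 2 x,
      forall x, \sum_(2 <= i < s.+1) emb (c i) ^+ 2 / 2 * b i x = phis 3 x &
      forall x, \sum_(2 <= i < s.+1) emb (c i) ^+ 3 / 6 * b i x = phis 4 x].
Proof.
move=> [b2 b3 b4].
have [d [cd _]] := two_nodes (leqnn s).
pose e := c s.
(* These are the coefficients of X (X - d) (X - e), a polynomial vanishing at all nodes, multiplied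
   by 1!, 2!, 3!. *)
have abc0 : [|| emb d * emb e != 0, - 2 * (emb d + emb e) != 0 | (6 : K) != 0].
  by rewrite pnatr_eq0 !orbT.
suff : \sum_(i <- [:: tt]) 1 * emb 1 = 0.
  by rewrite big_seq1 mul1r rmorph1 => /eqP; rewrite oner_eq0.
apply: (phis_free (b := fun=> 1) (c := fun=> 1) abc0 _ (rmorph0 emb)) => n.
rewrite big_seq1 rmorph1 !expr1n !mul1r.
rewrite -b2 -b3 -b4 !mulr_sumr -!big_split /= big_nat big1// => i /andP[i2 si].
have : (emb (c i)) * (emb (c i) - emb d) * (emb (c i) - emb e) = 0.
  move: si; rewrite ltnS leq_eqVlt => /predU1P[->|si].
    by rewrite subrr mulr0.
  have [->|->] : c i = 0 \/ c i = d by apply: cd; rewrite i2.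
    by rewrite rmorph0 !mul0r.
  by rewrite subrr mulr0 mul0r.
move=> hc; transitivity ((emb (c i)) * (emb (c i) - emb d) * (emb (c i) - emb e) * b i n%:R).
  by field.
by rewrite hc mul0r.
Qed.

End ScalarMethod.

(** * From matrices to scalars *)

Lemma diag_mx_mul_entry (K : comPzRingType) n (u v : 'rV[K]_n) (J : 'M[K]_n) i j :
  (diag_mx u *m J *m diag_mx v) i j = u 0 i * J i j * v 0 j.
Proof. by rewrite mul_diag_mx mul_mx_diag !mxE. Qed.

Lemma chain_mx_entry (K : comPzRingType) (u : 'rV[K]_3) (B : 'M[K]_3) :
  (diag_mx u *m (delta_mx 0 1 + delta_mx 1 2%:R) *m B) 0 2%:R = u 0 0 * B 1 2%:R.
Proof.
rewrite mul_diag_mx mxE (bigD1 1)//= big1 ?addr0; last first.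
  by move=> k; rewrite !mxE => /negPf ->; rewrite /= addr0 mulr0 mul0r.
by rewrite !mxE /= addr0 mulr1.
Qed.

Section ScalarCoefficients.
Variables (R : realType) (F : scalars) (s : nat) (M : expRKmethod R F s).
Local Notation K := (field_of R F).

Definition scalar_a (i j : nat) : K -> K := scalar_of (@acoef R F s M i j).
Definition scalar_b (i : nat) : K -> K := scalar_of (@bcoef R F s M i).

Lemma acoef_diag i j n (d : 'rV[K]_n) : (2 <= j < i)%N -> (i <= s)%N ->
  acoef M i j (diag_mx d) = diag_mx (map_mx (scalar_a i j) d).
Proof. by move=> /andP[j2 ji] si; rewrite (phi_comb_diagonal (erk_a M j2 ji si)). Qed.

Lemma bcoef_diag i n (d : 'rV[K]_n) : (2 <= i <= s)%N ->
  bcoef M i (diag_mx d) = diag_mx (map_mx (scalar_b i) d).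
Proof. by move=> /andP[i2 si]; rewrite (phi_comb_diagonal (erk_b M i2 si)). Qed.

Lemma psi_diag k i n (d : 'rV[K]_n) : (i <= s)%N ->
  psi M k i (diag_mx d)
  = diag_mx (map_mx (psis (node M) scalar_a k i) d).
Proof.
move=> si; apply/matrixP => l m.
rewrite !mxE summxE /psis mulrnBl -sumrMnl; congr (_ - _).
  rewrite !big_nat; apply: eq_bigr => q qi.
  by rewrite mxE acoef_diag// !mxE mulrnAr.
by rewrite scale_diag_mx phi_diag mxE mulrnAr.
Qed.

(* With [Z] diagonal and [J] the adjacency matrix of the path 0 -> 1 -> 2, the
   entries of the matrix conditions decouple the arguments of their factors. *)
Definition row3 (x y : K) : 'rV[K]_3 := \row_k [:: 0; x; y]`_k.
Definition diag3 (x y : K) : 'M[K]_3 := diag_mx (row3 x y).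
Definition path3 : 'M[K]_3 := delta_mx 0 1 + delta_mx 1 2%:R.

(** Only the first entry of [d] is prescribed, so that both b_i(Z) with [Z = diag3 x y] and b_i(0)
    are covered. *)
Lemma b_psi_entry k x y (d : 'rV[K]_3) : d 0 0 = 0 ->
  (\sum_(2 <= i < s.+1) bcoef M i (diag_mx d) *m path3 *m psi M k i (diag3 x y)) 0 1
  = \sum_(2 <= i < s.+1) scalar_b i 0 * psis (node M) scalar_a k i x.
Proof.
move=> d0; rewrite summxE !big_nat; apply: eq_bigr => i /andP[i2 si].
rewrite bcoef_diag ?i2// psi_diag// diag_mx_mul_entry !mxE d0 /=.
by rewrite addr0 mulr1.
Qed.

(** The only walk of length 2 from 0 to 2 passes through 1, so the three factors are read at the
    eigenvalues 0, x, y. *)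
Lemma b_a_psi_entry k x y (d : 'rV[K]_3) : d 0 0 = 0 ->
  (\sum_(2 <= i < s.+1) bcoef M i (diag_mx d) *m path3 *m
     (\sum_(2 <= j < i) acoef M i j (diag3 x y) *m path3 *m psi M k j (diag3 x y)))
    0 2%:R
  = \sum_(2 <= i < s.+1) scalar_b i 0 *
      (\sum_(2 <= j < i) scalar_a i j x * psis (node M) scalar_a k j y).
Proof.
move=> d0; rewrite summxE !big_nat; apply: eq_bigr => i /andP[i2 si].
rewrite bcoef_diag ?i2// chain_mx_entry mxE d0; congr (_ * _).
rewrite summxE !big_nat; apply: eq_bigr => j /andP[j2 ji].
rewrite acoef_diag ?j2// psi_diag ?(leq_trans (ltnW ji))//.
by rewrite diag_mx_mul_entry !mxE /= add0r mulr1.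
Qed.

Lemma b_moment_entry (w : nat -> K) x k :
  \sum_(2 <= i < s.+1) w i *: bcoef M i (x%:M : 'M[K]_1) = phi k x%:M ->
  \sum_(2 <= i < s.+1) w i * scalar_b i x = phis k x.
Proof.
move=> /matrixP/(_ 0 0); rewrite summxE /phis => <-.
by apply: eq_bigr => i _; rewrite mxE.
Qed.

End ScalarCoefficients.

(** A bilinear map with which to instantiate [conditions_9_16_b0]. *)
Definition bilinear0 (K : comNzRingType) n (u v : 'cV[K]_n) : 'cV[K]_n := 0.

Lemma bilinear0_is_bilinear (K : comNzRingType) n :
  bilinear_for (GRing.Scale.Law.clone _ _ *:%R _) (GRing.Scale.Law.clone _ _ *:%R _)
    (@bilinear0 K n).
Proof. by split=> u a x y; rewrite /bilinear0 /= scaler0 addr0. Qed.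

HB.instance Definition _ (K : comNzRingType) n :=
  bilinear_isBilinear.Build K 'cV[K]_n 'cV[K]_n 'cV[K]_n _ _ (@bilinear0 K n)
    (@bilinear0_is_bilinear K n).

Theorem theorem5p1 (R : realType) (F : scalars) (s : nat) :
  (s <= 6)%N -> ~ exists M : expRKmethod R F s, order5 M.
Proof.
move=> s6 [M [c17 _ c916]].
set K := field_of R F.
have c17d x y := c17 3 (diag3 x y) (path3 R F) 0.
have c916d x y := c916 3 (diag3 x y) (path3 R F) 0 0 (@bilinear0 K 3).
have b2 x : \sum_(2 <= i < s.+1) cnode M i * scalar_b M i x = phis 2 x.
  by apply: b_moment_entry; have [[]] := c17 1 x%:M 0 0.
have b3 x : \sum_(2 <= i < s.+1) cnode M i ^+ 2 / 2 * scalar_b M i x = phis 3 x.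
  by apply: b_moment_entry; have [[]] := c17 1 x%:M 0 0.
have b4 x : \sum_(2 <= i < s.+1) cnode M i ^+ 3 / 6 * scalar_b M i x = phis 4 x.
  by apply: b_moment_entry; have [_ []] := c17 1 x%:M 0 0.
have row30 x y : row3 x y 0 0 = 0 :> K by rewrite mxE.
have b0psi j : (2 <= j <= 4)%N -> forall x,
    \sum_(2 <= i < s.+1) scalar_b M i 0 * psis (node M) (scalar_a M) j i x = 0.
  move=> j24 x; have [->|[->|->]] : j = 2 \/ j = 3 \/ j = 4 by lia.
  - rewrite -(b_psi_entry M 2 x 0 (row30 x 0)).
    by have [[_ _ ->] _] := c17d x 0; rewrite mxE.
  - rewrite -(b_psi_entry M 3 x 0 (row30 x 0)).
    by have [_ [_ -> _ _]] := c17d x 0; rewrite mxE.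
  (* Here b_i is taken at the zero matrix, written as [diag_mx 0]. *)
  - rewrite -(b_psi_entry M 4 x 0 (mxE _ _ _ _ : (0 : 'rV[K]_3) 0 0 = 0)) linear0.
    by have [[-> _ _ _] _] := c916d x 0; rewrite mxE.
have b0apsi k : (2 <= k <= 3)%N -> forall x y,
    \sum_(2 <= i < s.+1) scalar_b M i 0 * (\sum_(2 <= j < i)
       scalar_a M i j x * psis (node M) (scalar_a M) k j y) = 0.
  move=> k23 x y; have [->|->] : k = 2 \/ k = 3 by lia.
  - rewrite -(b_a_psi_entry M 2 x y (row30 x y)).
    by have [_ [_ _ -> _]] := c17d x y; rewrite mxE.
  - rewrite -(b_a_psi_entry M 3 x y (mxE _ _ _ _ : (0 : 'rV[K]_3) 0 0 = 0)) linear0.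
    by have [[_ -> _ _] _] := c916d x y; rewrite mxE.
apply: (@no_scalar_method R F s (node M) (fun i => scalar_b M i 0) (scalar_a M)
  s6 _ b0psi b0apsi (scalar_b M)); last by split.
(* The remaining hypothesis is condition 1 at 0: the sum is phi_2(0) = 1/2. *)
under eq_bigr do rewrite mulrC.
by rewrite b2 phis2_0 mulf_neq0 ?oner_eq0// invr_eq0 pnatr_eq0.
Qed.
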